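(* Let $\mathcal{A}$ be a finite alphabet. Let $S$ be the space of all subshifts of $\mathcal{A}^{\mathbb{Z}}$ with the metric $d$ below, let $S^+\subseteq S$ be the subspace of subshifts with positive topological entropy, and for $c\geq 0$ let $S^+_{\geq c}\subseteq S$ be the subspace of subshifts with topological entropy at least $c$. Then: (i) the set of language stable subshifts in $S$ is a dense $G_\delta$ subset of $S$; (ii) the set of language stable subshifts in $S^+$ is a dense $G_\delta$ subset of $S^+$ (in the induced topology); (iii) for every $c\geq 0$, the set of language stable subshifts in $S^+_{\geq c}$ is a dense $G_\delta$ subset of $S^+_{\geq c}$ (in the induced topology).
   Context: A subshift is a closed (nonempty) subset $X\subseteq\mathcal{A}^{\mathbb{Z}}$ (product topology) that is invariant under the left shift $(\sigma x)_i=x_{i+1}$. The language $\mathcal{L}(X)$ is the set of finite words that occur as a block of consecutive symbols in some element of $X$, and $\mathcal{L}_n(X)$ is the set of words of length $n$ in it. The metric on subshifts of $\mathcal{A}^{\mathbb{Z}}$ is $d(X,Y)=2^{-\inf\{n\colon\mathcal{L}_n(X)\neq\mathcal{L}_n(Y)\}}$ (with $d(X,X)=0$), which induces the Hausdorff topology. A minimal forbidden word of $X$ is a finite word $w\notin\mathcal{L}(X)$ all of whose proper subwords lie in $\mathcal{L}(X)$; $\mathcal{M}_n(X)$ is the set of minimal forbidden words of length $n$. The upper Banach density of $E\subseteq\mathbb{N}$ is $d^*(E)=\limsup_{n\to\infty}\max_k |E\cap\{k,\dots,k+n-1\}|/n$. $X$ is language stable if $\{n\in\mathbb{N}\colon\mathcal{M}_n(X)=\emptyset\}$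 has upper Banach density $1$. *)

(* Defs.v *)
From HB Require Import structures.
From mathcomp Require Import all_boot all_order all_algebra.
From mathcomp Require Import all_classical all_reals all_analysis.

Set Implicit Arguments.
Unset Strict Implicit.
Unset Printing Implicit Defensive.

Import Order.TTheory GRing.Theory Num.Theory.
Import numFieldNormedType.Exports.

Local Open Scope classical_set_scope.
Local Open Scope ring_scope.

(* Bi-infinite sequences, with the product of the discrete topologies. *)
Definition config (A : finType) : Type := {ptws int -> discrete_topology A}.

Definition shift (A : finType) (x : config A) : config A := fun i => x (i + 1).

(* Invariance under the (invertible) shift means [shift X = X], not merely
   [shift X] included in [X]. *)
Record subshift (A : finType) := Subshift {
  points :> set (config A);
  subshift_neq0 : points !=set0;
  subshift_closed : closed points;
  subshift_invariant : @shift A @` points = points }.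

HB.instance Definition _ (A : finType) := gen_eqMixin (subshift A).
HB.instance Definition _ (A : finType) := gen_choiceMixin (subshift A).

Definition block (A : finType) (x : config A) (i : int) (n : nat) : seq A :=
  [seq x (i + j%:Z) | j <- iota 0 n].

Definition language (A : finType) (X : set (config A)) : set (seq A) :=
  [set w | exists2 x, X x & exists i : int, w = block x i (size w)].

Definition languagen (A : finType) (X : set (config A)) (n : nat) :
    {set n.-tuple A} :=
  finset (fun w : n.-tuple A => (w : seq A) \in language X).

Definition min_forbidden (A : finType) (X : set (config A)) : set (seq A) :=
  [set w | ~ language X w /\
    forall u : seq A, infix u w -> u != w -> language X u].

Definition min_forbiddenn (A : finType) (X : set (config A)) (n : nat) :
    {set n.-tuple A} :=
  finset (fun w : n.-tuple A => (w : seq A) \in min_forbidden X).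

(* The supremum over k is a maximum, as for fixed n there are finitely many
   values. *)
Definition upper_banach_density (R : realType) (E : set nat) : R :=
  limn_sup (fun n : nat =>
    sup [set ((count (fun i => i \in E) (iota k n))%:R / n%:R : R)
        | k in [set: nat]]).

Definition language_stable (R : realType) (A : finType) (X : subshift A) :=
  upper_banach_density R [set n | min_forbiddenn X n = finset.set0] = 1.

(* Topological entropy of the shift map on X, as the exponential growth rate of
   the number of words (the limit exists by subadditivity); natural logarithm. *)
Definition entropy (R : realType) (A : finType) (X : subshift A) : R :=
  limn (fun n : nat => ln (#|languagen X n|%:R) / n%:R : R).

Section SubshiftMetric.
Variables (R : realType) (A : finType).
Implicit Types X Y Z : subshift A.

Definition separating X Y : set nat := [set n | languagen X n != languagen Y n].

(* inf { n | L_n(X) <> L_n(Y) }, computed in R. *)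
Definition subshift_dist X Y : R :=
  if X == Y then 0 else 2 `^ (- inf [set (n%:R : R) | n in separating X Y]).

Lemma subshift_eq X Y : points X = points Y -> X = Y.
Proof.
case: X => X X1 X2 X3; case: Y => Y Y1 Y2 Y3 /= XY; rewrite XY in X1 X2 X3 *.
by congr Subshift; exact: Prop_irrelevance.
Qed.

Lemma size_block (x : config A) i n : size (block x i n) = n.
Proof. by rewrite size_map size_iota. Qed.

Lemma iter_shift n (x : config A) i : iter n (@shift A) x i = x (i + n%:Z).
Proof.
elim: n x i => [|n IHn] x i; first by rewrite addr0.
by rewrite iterSr IHn /shift -addrA -addn1 PoszD.
Qed.

Lemma iter_shift_sub X n x : points X x -> points X (iter n (@shift A) x).
Proof.
move=> Xx; elim: n => //= n; rewrite -{2}(subshift_invariant X) => Xn.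
by exists (iter n (@shift A) x).
Qed.

Lemma iter_shift_surj X n x : points X x ->
  exists2 y, points X y & iter n (@shift A) y = x.
Proof.
elim: n x => [|n IHn] x Xx; first by exists x.
move: Xx; rewrite -{1}(subshift_invariant X) => -[y /IHn[z Xz <-] <-].
by exists z.
Qed.

Lemma translate_in X x (m : int) : points X x ->
  exists2 y, points X y & forall i, y i = x (i + m).
Proof.
move=> Xx; case: m => n.
  exists (iter n (@shift A) x); first exact: iter_shift_sub.
  by move=> i; rewrite iter_shift.
have [y Xy yx] := iter_shift_surj n.+1 Xx.
exists y => // i; rewrite -yx iter_shift NegzE; congr (y _).
by rewrite subrK.
Qed.

Lemma language_points X (x : config A) :
  (forall i n, language X (block x i n)) -> points X x.
Proof.
move=> Lx.
have ex (n : nat) : {y : config A |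
    points X y /\ forall i : int, `|i| <= n%:Z -> y i = x i}.
  apply: cid; have [z Xz [m]] := Lx (- n%:Z) (n + n).+1.
  rewrite size_block => xz.
  have [y Xy yz] := translate_in (m + n%:Z) Xz.
  exists y; split=> // i; rewrite ler_norml => /andP[ni im].
  have [k ik] : exists k : nat, i + n%:Z = k%:Z.
    have : 0 <= i + n%:Z by rewrite -lerBlDr sub0r.
    by case: (i + n%:Z) => // k _; exists k.
  have kn : (k < (n + n).+1)%N.
    by rewrite ltnS -lez_nat -ik PoszD lerD2r.
  have := congr1 (fun s => nth (x i) s k) xz.
  rewrite !(nth_map 0%N) ?size_iota // nth_iota // add0n.
  rewrite yz -ik [- _ + _]addrC addrK => ->; congr (z _).
  by rewrite addrCA.
pose y n := sval (ex n).
have Xy n : points X (y n) by case: (svalP (ex n)).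
have yx n i : `|i| <= n%:Z -> y n i = x i.
  by case: (svalP (ex n)) => _; apply.
have y_cvg : y @ \oo --> (x : {ptws int -> discrete_topology A}).
  apply/cvg_sup => i U [V [[W oW <-] /= Wxi WU]].
  apply: (filterS WU); exists `|i|%N => // n /= ni.
  by rewrite yx // -abszE lez_nat.
by apply: (closed_cvg _ (@subshift_closed A X) _ _ y_cvg); exact: nearW.
Qed.

Lemma separatingP X Y : separating X Y = set0 -> X = Y.
Proof.
move=> XY0.
have LE n : languagen X n = languagen Y n.
  apply/eqP/negPn/negP => XYn.
  by have : separating X Y n by []; rewrite XY0.
have L w : language X w <-> language Y w.
  have /setP/(_ (in_tuple w)) := LE (size w); rewrite !inE.
  move=> e; split=> H.
    by apply: set_mem; rewrite -e; exact: mem_set.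
  by apply: set_mem; rewrite e; exact: mem_set.
have Lx Z z i n : points Z z -> language Z (block z i n).
  by move=> Zz; exists z => //; exists i; rewrite size_block.
apply: subshift_eq; apply/seteqP; split => x Hx; apply: language_points => i n.
  by apply/L; exact: Lx.
by apply/L; exact: Lx.
Qed.

Lemma subshift_dist_xx X : subshift_dist X X = 0.
Proof. by rewrite /subshift_dist eqxx. Qed.

Lemma subshift_dist_eq0 X Y : subshift_dist X Y = 0 -> X = Y.
Proof.
rewrite /subshift_dist; case: eqP => // _ /eqP.
by rewrite gt_eqF // powR_gt0.
Qed.

Lemma subshift_dist_ge0 X Y : 0 <= subshift_dist X Y.
Proof. by rewrite /subshift_dist; case: eqP => // _; exact: powR_ge0. Qed.

Lemma subshift_dist_sym X Y : subshift_dist X Y = subshift_dist Y X.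
Proof.
have sepC : separating X Y = separating Y X.
  by apply/funext => n; rewrite /separating /= eq_sym.
by rewrite /subshift_dist sepC eq_sym.
Qed.

Lemma inf_separating X Y n : separating X Y n ->
  inf [set (m%:R : R) | m in separating X Y] <= n%:R.
Proof.
move=> XYn; apply: ge_inf; last by exists n.
by exists 0 => _ [m _ <-].
Qed.

Lemma subshift_dist_triangle Y X Z :
  subshift_dist X Z <= subshift_dist X Y + subshift_dist Y Z.
Proof.
have [->|XZ] := eqVneq X Z.
  by rewrite subshift_dist_xx addr_ge0 // subshift_dist_ge0.
have [->|XY] := eqVneq X Y; first by rewrite subshift_dist_xx add0r.
have [->|YZ] := eqVneq Y Z; first by rewrite subshift_dist_xx addr0.
rewrite /subshift_dist (negbTE XY) (negbTE YZ) (negbTE XZ).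
set a := inf _; set b := inf _; set c := inf _.
have le_min : Order.min b c <= a.
  apply: lb_le_inf.
    have /set0P[n XZn] : separating X Z != set0.
      by apply: contra XZ => /eqP/separatingP ->.
    by exists n%:R; exists n.
  move=> _ [n XZn <-]; rewrite ge_min.
  have [XYn|/eqP XYn] := eqVneq (languagen X n) (languagen Y n).
    by rewrite [c <= _]inf_separating ?orbT // /separating /= -XYn.
  by rewrite [b <= _]inf_separating //; apply/eqP.
have p (u v : R) : u <= v -> 2 `^ (- v) <= 2 `^ (- u) :> R.
  by move=> uv; rewrite ler_powR ?lerN2 // ler1n.
move: le_min; rewrite ge_min => /orP[/p h|/p h]; apply: (le_trans h).
  by rewrite lerDl powR_ge0.
by rewrite lerDr powR_ge0.
Qed.

End SubshiftMetric.

(* The type of subshifts as a metric space; R only serves as the codomain of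
   the distance. *)
Definition subshift_space (R : realType) (A : finType) : Type := subshift A.
HB.instance Definition _ (R : realType) (A : finType) :=
  Choice.on (subshift_space R A).
HB.instance Definition _ (R : realType) (A : finType) :=
  @isMetric.Build R (subshift_space R A) (@subshift_dist R A)
    (@subshift_dist_xx R A) (@subshift_dist_eq0 R A) (@subshift_dist_sym R A)
    (@subshift_dist_triangle R A).

Definition positive_entropy (R : realType) (A : finType) :
    set (subshift_space R A) :=
  [set X | 0 < entropy R X].

Definition entropy_ge (R : realType) (A : finType) (c : R) :
    set (subshift_space R A) :=
  [set X | c <= entropy R X].

(* Main.v *)
(* A set of integers has upper Banach density 1 iff it contains arbitrarily long
   intervals.  Whether M_n(X) is empty for all n in a given interval depends only
   on finitely many L_m(X), hence is an open condition on X, so language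
   stability is a G_delta condition.  For density, the subshift of finite type Y
   whose points are the sequences with all N-blocks in L_N(X) contains X, has the
   same language up to length N, and M_n(Y) is empty for all n > N.  As Y
   contains X its entropy is at least that of X (the limits defining the two
   entropies exist by Fekete's lemma), so the approximation stays in S^+ and in
   S^+_{>= c}. *)

Require Import Defs.
From HB Require Import structures.
From mathcomp Require Import all_boot all_order all_algebra.
From mathcomp Require Import all_classical all_reals all_analysis.
From mathcomp Require Import borel_hierarchy.
From mathcomp Require Import zify ring lra.

Set Implicit Arguments.
Unset Strict Implicit.
Unset Printing Implicit Defensive.

Import Order.TTheory GRing.Theory Num.Theory.
Import numFieldNormedType.Exports.

Local Open Scope classical_set_scope.
Local Open Scope ring_scope.

(** * Fekete's lemma *)

(** Fix [m] with [u m / m] within [e / 2] of the infimum. Cutting [n] into pieces of length [m] and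
    a short remainder bounds [u n] by [(n / m) u m] plus a constant, which is at most [e / 2 * n]
    for large [n]. *)
Lemma cvg_subadditive (R : realType) (u : nat -> R) :
  (forall m n, u (m + n)%N <= u m + u n) -> (forall n, 0 <= u n) ->
  u n / n%:R @[n --> \oo] --> inf [set u n / n%:R | n in [set n | (0 < n)%N]].
Proof.
move=> uD u0; set E := [set _ | _ in _]; set l := inf E.
have E0 : has_inf E.
  split; first by exists (u 1%N / 1%:R); exists 1%N.
  by exists 0 => _ [n _ <-]; rewrite divr_ge0.
have u1 r : u r.+1 <= r.+1%:R * u 1%N.
  elim: r => [|r IHr]; first by rewrite mul1r.
  rewrite -addn1 (le_trans (uD _ _))// natrD mulrDl mul1r lerD2r; exact: IHr.
have uq m r q : u (q * m + r)%N <= q%:R * u m + u r.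
  elim: q => [|q IHq]; first by rewrite mul0n add0n mul0r add0r.
  by rewrite mulSn -addnA (le_trans (uD _ _))// -natr1 mulrDl mul1r; lra.
apply/cvgrPdist_le => e e0.
have e20 : 0 < e / 2 by rewrite divr_gt0.
have [_ [m m0 <-] me] := inf_adherent e20 E0.
near=> n.
have n0 : (0 < n)%N by near: n; exact: nbhs_infty_gt.
have nR : 0 < n%:R :> R by rewrite ltr0n.
have mR : 0 < m%:R :> R by rewrite ltr0n.
have le_n : m%:R * u 1%N <= e / 2 * n%:R.
  by rewrite mulrC -ler_pdivrMl//; near: n; exact: nbhs_infty_ger.
have ln : l <= u n / n%:R by apply: ge_inf; [case: E0|exists n].
(* Dividing [n - 1] keeps the remainder between 1 and [m]: [u1] says nothing about [u 0], which may
   be positive. *)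
have nE : n = (n.-1 %/ m * m + (n.-1 %% m).+1)%N.
  by rewrite addnS -divn_eq prednK.
have un : u n <= (n%:R / m%:R) * u m + m%:R * u 1%N.
  rewrite {1}nE (le_trans (uq _ _ _))// lerD//.
    rewrite ler_wpM2r// ler_pdivlMr// -natrM ler_nat.
    by rewrite (leq_trans (leq_trunc_div _ _))// leq_pred.
  by rewrite (le_trans (u1 _))// ler_wpM2r// ler_nat ltn_pmod.
have : u n / n%:R <= u m / m%:R + e / 2.
  rewrite ler_pdivrMr// (le_trans un)// mulrDl; apply: lerD => //.
  by rewrite le_eqVlt; apply/orP; left; apply/eqP; ring.
rewrite -/l in me.
by rewrite ler_distlC => h; apply/andP; split; lra.
Unshelve. all: by end_near. Qed.

(** * Upper Banach density 1 and long intervals *)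

Section Density.
Variable R : realType.
Implicit Type E : set nat.

(** Each of the [q] consecutive windows of length [L] loses at least one point. *)
Lemma count_iota_gap E L : (0 < L)%N ->
    (forall k, exists2 i, (k <= i < k + L)%N & ~ E i) ->
  forall q k, (count (fun i => i \in E) (iota k (q * L)) + q <= q * L)%N.
Proof.
move=> L0 gap; elim=> [|q IHq] k; first by [].
rewrite mulSn iotaD count_cat.
suff : (count (fun i => i \in E) (iota k L) < L)%N by have := IHq (k + L)%N; lia.
rewrite -[X in (_ < X)%N](size_iota k) ltn_neqAle count_size andbT -all_count.
apply/negP => /allP kE; have [i ki []] := gap k; apply: set_mem.
by apply: kE; rewrite mem_iota.
Qed.

(** The factor 2 absorbs the incomplete last window: for [L <= n] the number of full windows is at
    least [n / (2 L)]. *)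
Lemma count_iota_gap_le E L : (0 < L)%N ->
    (forall k, exists2 i, (k <= i < k + L)%N & ~ E i) ->
  forall n k, (L <= n)%N ->
  (count (fun i => i \in E) (iota k n))%:R / n%:R <= 1 - (2 * L)%:R^-1 :> R.
Proof.
move=> L0 gap n k Ln; have n0 : (0 < n)%N by exact: leq_trans Ln.
rewrite ler_pdivrMr ?ltr0n// mulrBl mul1r lerBrDr addrC.
set c := count _ _.
have cn : (c + n %/ L <= n)%N.
  have := count_iota_gap L0 gap (n %/ L) k.
  have -> : c = (count (fun i => i \in E) (iota k (n %/ L * L)) +
      count (fun i => i \in E) (iota (k + n %/ L * L) (n %% L)))%N.
    by rewrite -count_cat -iotaD -divn_eq.
  have := divn_eq n L.
  have := count_size (fun i => i \in E) (iota (k + n %/ L * L) (n %% L)).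
  by rewrite size_iota; lia.
have nL : (n <= n %/ L * (2 * L))%N.
  have : (0 < n %/ L)%N by rewrite divn_gt0.
  by have := ltn_pmod n L0; have := divn_eq n L; nia.
apply: (@le_trans _ _ ((n %/ L)%:R + c%:R)).
  by rewrite lerD2r ler_pdivrMl ?ltr0n ?muln_gt0// mulrC -natrM ler_nat.
by rewrite -natrD ler_nat addnC.
Qed.

Lemma upper_banach_density_eq1P E : upper_banach_density R E = 1 <->
  forall L, exists k, forall i, (k <= i < k + L)%N -> E i.
Proof.
rewrite /upper_banach_density.
pose f n k : R := (count (fun i => i \in E) (iota k n))%:R / n%:R.
rewrite -[X in limn_sup X]/(fun n => sup [set f n k | k in setT]).
set F := fun n => sup _.
have f1 n k : f n k <= 1.
  case: n => [|n]; first by rewrite /f /= mul0r.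
  by rewrite ler_pdivrMr// mul1r ler_nat (leq_trans (count_size _ _))// size_iota.
have F1 n : F n <= 1 by apply: ge_sup => [|_ [k _ <-]//]; exists (f n 0%N), 0%N.
have fF n k : f n k <= F n.
  by apply: ub_le_sup; [exists 1 => _ [j _ <-]|exists k].
have F0 n : 0 <= F n by rewrite (le_trans _ (fF n 0%N))// divr_ge0.
split=> [FE L|runs].
  have [|] := pselect (exists k, forall i, (k <= i < k + L)%N -> E i) => // nex.
  exfalso.
  have gap k : exists2 i, (k <= i < k + L)%N & ~ E i.
    apply: contrapT => nk; apply: nex; exists k => i ki.
    by apply: contrapT => Ei; apply: nk; exists i.
  have L0 : (0 < L)%N by have [i] := gap 0%N; lia.
  (* Boundedness lets [limn_supE] turn the upper limit into the infimum of [sups F], which is then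
     bounded by its term at [L]. *)
  have bF : bounded_fun (F : R^o^nat).
    exists 1; split=> // M M1 n _ /=.
    by rewrite ger0_norm// (le_trans (F1 _))// ltW.
  move: FE; rewrite limn_supE// => /eqP; apply/negP; rewrite lt_eqF//.
  apply: (@le_lt_trans _ _ (1 - (2 * L)%:R^-1)); last first.
    by rewrite ltrBlDr ltrDl invr_gt0 ltr0n muln_gt0.
  apply: (@le_trans _ _ (sups (F : R^o^nat) L)).
    apply: ge_inf; last by exists L.
    exact: bounded_fun_has_lbound_sups.
  apply: ge_sup; first by exists (F L); exists L => /=.
  move=> _ [n /= Ln <-]; apply: ge_sup; first by exists (f n 0%N), 0%N.
  by move=> _ [k _ <-]; exact: (count_iota_gap_le L0 gap).
(* A run of length [n] makes [F n] equal to 1, except at [n = 0], where the quotient is 0. *)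
have F11 : (F : R^o^nat) @ \oo --> (1 : R^o).
  apply: cvg_near_cst; near=> n.
  have n0 : (0 < n)%N by near: n; exact: nbhs_infty_gt.
  apply/eqP; rewrite eq_le F1/=.
  have [k kE] := runs n; apply: le_trans (fF n k).
  rewrite /f (_ : count _ _ = n) ?divff ?pnatr_eq0 -?lt0n//.
  rewrite -[RHS](size_iota k); apply/eqP; rewrite -all_count.
  by apply/allP => i; rewrite mem_iota => /kE ?; exact/mem_set.
by have [_ ->] := cvg_limn_inf_sup F11.
Unshelve. all: by end_near. Qed.

End Density.

(** * Words, languages and entropy *)

Section Language.
Variable A : finType.
Implicit Types (X Y : subshift A) (x y : config A) (u v w : seq A).

Lemma nth_block (a : A) x i n j : (j < n)%N -> nth a (block x i n) j = x (i + j%:Z).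
Proof. by move=> jn; rewrite (nth_map 0%N) ?size_iota// nth_iota. Qed.

Lemma block_cat x i m n : block x i (m + n) = block x i m ++ block x (i + m%:Z) n.
Proof.
rewrite /block iotaD map_cat add0n; congr (_ ++ _).
rewrite -[in LHS](addn0 m) iotaDl -map_comp; apply: eq_map => j /=.
by rewrite PoszD addrA.
Qed.

Lemma eq_block x y i k n :
  (forall j, (j < n)%N -> x (i + j%:Z) = y (k + j%:Z)) -> block x i n = block y k n.
Proof. by move=> xy; apply/eq_in_map => j; rewrite mem_iota => /xy. Qed.

Lemma language_block (S : set (config A)) x i n : S x -> language S (block x i n).
Proof. by exists x => //; exists i; rewrite size_block. Qed.

(** Invariance under translations in both directions moves any occurrence to position 0. *)
Lemma languageP X w : language X w -> exists2 x, points X x & block x 0 (size w) = w.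
Proof.
move=> [x Xx [m ->]]; have [y Xy yx] := translate_in m Xx.
exists y => //; rewrite size_block; apply: eq_block => j _.
by rewrite yx add0r addrC.
Qed.

Lemma language_catl X u v : language X (u ++ v) -> language X u.
Proof.
move=> [x Xx [i]]; rewrite size_cat block_cat => /eqP.
rewrite eqseq_cat ?size_block// => /andP[/eqP -> _]; exact: language_block.
Qed.

Lemma language_catr X u v : language X (u ++ v) -> language X v.
Proof.
move=> [x Xx [i]]; rewrite size_cat block_cat => /eqP.
rewrite eqseq_cat ?size_block// => /andP[_ /eqP ->]; exact: language_block.
Qed.

Lemma languageS (S T : set (config A)) : S `<=` T -> language S `<=` language T.
Proof. by move=> ST w [x Sx xw]; exists x => //; exact: ST. Qed.

Lemma in_languagen (S : set (config A)) n (w : n.-tuple A) :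
  (w \in languagen S n) = (tval w \in language S).
Proof. by rewrite inE. Qed.

Lemma eq_languagenP X Y n : languagen X n = languagen Y n <->
  forall w, size w = n -> (language X w <-> language Y w).
Proof.
split=> [+ w wn|XY].
  rewrite -wn => /setP/(_ (in_tuple w)); rewrite !in_languagen/= => e.
  by split=> /mem_set; [rewrite e|rewrite -e] => /set_mem.
by apply/setP => w; rewrite !in_languagen; apply/idP/idP => /set_mem h;
  apply/mem_set/XY; rewrite ?size_tuple.
Qed.

Lemma languagen_gt0 X n : (0 < #|languagen X n|)%N.
Proof.
have [x Xx] := subshift_neq0 X.
apply/card_gt0P; exists (tcast (size_block x 0 n) (in_tuple (block x 0 n))).
by rewrite in_languagen val_tcast; apply/mem_set/language_block.
Qed.

Lemma subset_languagen X Y n : X `<=` Y -> (languagen X n \subset languagen Y n).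
Proof.
move=> XY; apply/fintype.subsetP => w; rewrite !in_languagen => /set_mem h.
by apply/mem_set; exact: languageS h.
Qed.

(** Cutting a word after [m] letters is injective, and both pieces stay in the language. *)
Lemma card_languagenD X m n :
  (#|languagen X (m + n)| <= #|languagen X m| * #|languagen X n|)%N.
Proof.
rewrite -cardsX.
have szl (w : (m + n).-tuple A) : size (take m w) == m.
  by rewrite size_takel// size_tuple leq_addr.
have szr (w : (m + n).-tuple A) : size (drop m w) == n.
  by rewrite size_drop size_tuple addKn.
pose f (w : (m + n).-tuple A) : m.-tuple A * n.-tuple A := (Tuple (szl w), Tuple (szr w)).
have f_inj : injective f.
  move=> v w [vwl vwr]; apply/val_inj.
  by rewrite /= -(cat_take_drop m v) vwl vwr cat_take_drop.
rewrite -(card_imset _ f_inj) subset_leq_card//.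
apply/fintype.subsetP => _ /imsetP[w + ->]; rewrite finset.in_setX !in_languagen/= => /set_mem.
rewrite -{1}(cat_take_drop m w) => Xw.
by apply/andP; split; apply/mem_set; [exact: language_catl Xw|exact: language_catr Xw].
Qed.

Lemma entropy_cvg (R : realType) X :
  cvgn (fun n : nat => ln (#|languagen X n|%:R) / n%:R : R).
Proof.
apply/cvg_ex; eexists.
apply: (@cvg_subadditive R (fun n => ln #|languagen X n|%:R)) => [m n|n].
  rewrite -lnM ?posrE ?ltr0n ?languagen_gt0// -natrM.
  by rewrite ler_ln ?posrE ?ltr0n ?muln_gt0 ?languagen_gt0// ler_nat card_languagenD.
by rewrite ln_ge0// ler1n languagen_gt0.
Qed.

(** Comparing the limits termwise relies on [entropy_cvg] for both subshifts. *)
Lemma le_entropy (R : realType) X Y : X `<=` Y -> entropy R X <= entropy R Y.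
Proof.
move=> XY; apply: ler_lim; [exact: entropy_cvg|exact: entropy_cvg|].
apply: nearW => n; rewrite ler_wpM2r// ler_ln ?posrE ?ltr0n ?languagen_gt0//.
by rewrite ler_nat subset_leq_card// subset_languagen.
Qed.

Lemma min_forbiddenn_eq0P X n : min_forbiddenn X n = finset.set0 <->
  forall w, size w = n -> ~ min_forbidden X w.
Proof.
split=> [/setP X0 w wn Xw|X0].
  have := X0 (tcast wn (in_tuple w)).
  by rewrite !inE val_tcast => /negP; apply; exact: mem_set.
apply/setP => w; rewrite !inE; apply/negP => /set_mem; apply: X0.
by rewrite size_tuple.
Qed.

(** Being minimal forbidden only tests a word and its subwords, none longer than the word. *)
Lemma min_forbiddenn_eq0_local X Y N n :
    (forall m, (m <= N)%N -> languagen X m = languagen Y m) -> (n <= N)%N ->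
  min_forbiddenn X n = finset.set0 -> min_forbiddenn Y n = finset.set0.
Proof.
move=> XY nN /min_forbiddenn_eq0P X0; apply/min_forbiddenn_eq0P => w wn [Yw Yu].
have L u : (size u <= N)%N -> language X u <-> language Y u.
  by move=> /XY/eq_languagenP; exact.
apply: (X0 w wn); split; first by rewrite L ?wn.
move=> u uw u_neq; apply/L; last exact: Yu.
by rewrite (leq_trans (size_infix uw))// wn.
Qed.

(** * Approximation by subshifts of finite type *)

Section SFT.
Variables (X : subshift A) (N : nat).

Definition sft_points : set (config A) :=
  [set y | forall i, language X (block y i N)].

Lemma sub_sft_points : X `<=` sft_points.
Proof. by move=> x Xx i; exact: language_block. Qed.

Lemma sft_points_neq0 : sft_points !=set0.
Proof. by have [x Xx] := subshift_neq0 X; exists x; exact: sub_sft_points. Qed.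

(** A cylinder is a finite intersection of preimages of singletons, open in the discrete alphabet,
    under coordinate projections. *)
Lemma nbhs_eq_block (x : {ptws int -> discrete_topology A}) i n :
  nbhs x [set y | block y i n = block x i n].
Proof.
elim: n => [|n IHn]; first exact: filterS filterT.
have xn := @proj_continuous int (fun=> discrete_topology A) (i + n%:Z) x _
  (discrete_set1 _).
apply: filterS (filterI IHn xn) => y [/= yx yxn].
by rewrite -addn1 !block_cat yx /block/= !addr0; congr (_ ++ [:: _]).
Qed.

Lemma sft_points_closed : closed sft_points.
Proof.
move=> x clx i; have [y [Yy <-]] := clx _ (nbhs_eq_block x i N); exact: Yy.
Qed.

Lemma sft_points_invariant : @Defs.shift A @` sft_points = sft_points.
Proof.
apply/seteqP; split=> [_ [y Yy <-] i|y Yy].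
  suff -> : block (Defs.shift y) i N = block y (i + 1) N by exact: Yy.
  by apply: eq_block => j _; rewrite /Defs.shift addrAC.
exists (fun i => y (i - 1)); last by apply/funext => i; rewrite /Defs.shift addrK.
move=> i; suff -> : block (fun i => y (i - 1)) i N = block y (i - 1) N by exact: Yy.
by apply: eq_block => j _; rewrite addrAC.
Qed.

Definition sft : subshift A :=
  Subshift sft_points_neq0 sft_points_closed sft_points_invariant.

(** A word of length at most [N] at position 0 is a prefix of the [N]-block there, which is in the
    language of [X]. *)
Lemma languagen_sft n : (n <= N)%N -> languagen sft n = languagen X n.
Proof.
move=> nN; apply/eq_languagenP => w wn; split; last exact: (languageS sub_sft_points).
move=> /languageP[y Yy]; rewrite wn => <-.
by have := Yy 0; rewrite -(subnKC nN) block_cat; exact: language_catl.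
Qed.

(* The prefix and the suffix of length n-1 of a word w of length n > N overlap in
   at least N-1 letters, so if two points of sft contain them, every N-block of
   the sequence glued along the overlap lies in one of the two points. *)
Lemma min_forbiddenn_sft n : (0 < N)%N -> (N < n)%N ->
  min_forbiddenn sft n = finset.set0.
Proof.
move=> N0 Nn; apply/min_forbiddenn_eq0P => w wn [nYw Yw]; apply: nYw.
case: w wn Yw => [|a w] wn Yw; first by rewrite -wn ltn0 in Nn.
have [x Yx xw] : exists2 x, points sft x & block x 0 n.-1 = take n.-1 (a :: w).
  have := @languageP sft (take n.-1 (a :: w)).
  rewrite size_takel ?wn ?leq_pred//; apply; apply: Yw; first exact: infix_take.
  by apply/eqP => /(congr1 size); rewrite size_takel ?wn ?leq_pred//; lia.
have [y Yy yw] : exists2 y, points sft y & block y 0 n.-1 = w.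
  rewrite -wn; apply: (@languageP sft w); apply: Yw; first exact: infix_cons.
  by apply/eqP => /(congr1 size) /=; lia.
(* The point [y] spells the tail of the word from position 0, so it is moved right by one to line up
   with [x]. *)
pose z : config A := fun i => if i < n.-1%:Z then x i else y (i - 1).
have zx i : i < n.-1%:Z -> z i = x i by rewrite /z => ->.
(* On positions 1 to [n - 2] both [x] and the moved [y] spell the word, so they agree there. *)
have zy i : 1 <= i -> z i = y (i - 1).
  rewrite /z; case: ltP => // il i1.
  have [j ij] : exists j, i = j.+1%:Z by exists `|i|%N.-1; lia.
  have jn : (j.+1 < n.-1)%N by lia.
  rewrite {}ij -(add0r j.+1%:Z) -(nth_block a _ _ jn) xw nth_take//=.
  by rewrite -yw nth_block; [congr (y _); lia|lia].
exists z; last first.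
  exists 0; apply: (@eq_from_nth _ a); first by rewrite size_block.
  move=> j; rewrite wn => jn; rewrite nth_block// add0r.
  case: j jn => [|j] jn.
    rewrite zx; last by lia.
    rewrite -(add0r 0%:Z) -(nth_block a x 0 (n := n.-1)); last by lia.
    by rewrite xw nth_take//; lia.
  rewrite zy//= -yw nth_block; last by lia.
  by congr (y _); lia.
(* A window starting at [i <= 0] ends by [N - 1 < n - 1], where [z] is [x]; one starting at [i >= 1]
   sees only the moved [y]. *)
move=> i; case: (lerP i 0) => i0.
  rewrite (@eq_block z x i i); first exact: Yx.
  by move=> j jN; rewrite zx//; lia.
rewrite (@eq_block z y i (i - 1)); first exact: Yy.
by move=> j jN; rewrite zy; [congr (y _); lia|lia].
Qed.

Lemma language_stable_sft (R : realType) : (0 < N)%N -> language_stable R sft.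
Proof.
move=> N0; apply/upper_banach_density_eq1P => L; exists N.+1 => i /andP[Ni _].
exact: min_forbiddenn_sft.
Qed.

End SFT.

End Language.

(** * The topology on the space of subshifts *)

Section Topology.
Variables (R : realType) (A : finType).
Local Notation S := (subshift_space R A).

Lemma ball_subshift_eq_languagen (X Y : S) (N : nat) :
  ball X (2 `^ (- N%:R)) Y -> forall n, (n <= N)%N -> languagen X n = languagen Y n.
Proof.
rewrite ballEmdist /= => XY n nN; apply/eqP/negPn/negP => nXY; move: XY.
apply/negP; rewrite -leNgt /mdist/= /subshift_dist ifF; last first.
  by apply/eqP => XY; rewrite XY eqxx in nXY.
rewrite ler_powR ?ler1n// lerN2 (@le_trans _ _ n%:R) ?ler_nat//.
exact: inf_separating.
Qed.

(** This reduces the topology to words: agreement up to length [N] gives distance at most [2^-N],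
    and distance below [2^-N] gives back that agreement. *)
Lemma nbhs_subshiftP (X : S) (U : set S) : nbhs X U <->
  exists N : nat, forall Y : S,
    (forall n, (n <= N)%N -> languagen X n = languagen Y n) -> U Y.
Proof.
split=> [/nbhs_ballP[e /= e0 eU]|[N NU]]; last first.
  apply/nbhs_ballP; exists (2 `^ (- N%:R)) => /=; first exact: powR_gt0.
  by move=> Y /ball_subshift_eq_languagen; exact: NU.
have [N Ne] : exists N : nat, (2 `^ (- N%:R) : R) < e.
  have [N _ /(_ N (leqnn N)) /=] := near_infty_natSinv_expn_lt (PosNum e0).
  by exists N; rewrite powRN powR_mulrn// -div1r.
exists N => Y XY; apply: eU; rewrite ballEmdist /= /mdist/= /subshift_dist.
case: eqP => // /eqP nXY; apply: le_lt_trans Ne.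
rewrite ler_powR ?ler1n// lerN2; apply: lb_le_inf.
  (* The lower bound on [inf] needs a nonempty set, which distinct subshifts provide. *)
  have /set0P[n XYn] : separating X Y != set0.
    by apply: contra nXY => /eqP/separatingP ->.
  by exists n%:R; exists n.
move=> _ [n /eqP nXYn <-]; rewrite ler_nat leqNgt; apply/negP => nN.
by apply: nXYn; apply: XY; exact: ltnW.
Qed.

Lemma Gdelta_language_stable : Gdelta [set X : S | language_stable R X].
Proof.
exists (fun L => [set X : S | exists k, forall i, (k <= i < k + L)%N ->
    min_forbiddenn X i = finset.set0]).
  move=> L; rewrite openE => X [k Xk]; apply/nbhs_subshiftP.
  exists (k + L)%N => Y XY; exists k => i ki.
  by apply: (min_forbiddenn_eq0_local XY); [lia|exact: Xk].
by apply/seteqP; split=> X /=; [move=> /upper_banach_density_eq1P h L _; exact: h|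
  move=> h; apply/upper_banach_density_eq1P => L; exact: h].
Qed.

Lemma near_language_stable (X : S) (U : set S) : nbhs X U ->
  exists Y : S, [/\ U Y, language_stable R Y & X `<=` Y].
Proof.
(* Using [N + 1] gives the positive block length that [language_stable_sft] requires, even for
   [N = 0]. *)
move=> /nbhs_subshiftP[N NU]; exists (sft X N.+1); split.
- by apply: NU => n nN; rewrite languagen_sft// ltnW.
- exact: language_stable_sft.
- exact: sub_sft_points.
Qed.

(** Both entropy conditions are inherited by larger subshifts, so the approximation, which contains
    [X], stays in [P]. Open sets of the subspace are preimages under [\val]. *)
Lemma Gdelta_dense_language_stable (P : set S) :
  (forall X Y : S, X `<=` Y -> P X -> P Y) ->
  Gdelta [set X : set_type P | language_stable R (\val X)] /\
  dense [set X : set_type P | language_stable R (\val X)].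
Proof.
move=> PS; split.
  have [F oF SF] := Gdelta_language_stable.
  exists (fun n => \val @^-1` F n) => [n|]; first by exists (F n).
  by rewrite -preimage_bigcap -SF.
move=> O [X OX] [U oU UO]; move: OX; rewrite -UO => UX.
have [Y [UY sY XY]] := near_language_stable (open_nbhs_nbhs (conj oU UX)).
have PY : P Y by apply: PS XY _; exact: set_mem (valP X).
by exists (SigSub (mem_set PY)).
Qed.

End Topology.

Theorem corollary5p4 (R : realType) (A : finType) :
  [/\ Gdelta [set X : subshift_space R A | language_stable R X] /\
      dense [set X : subshift_space R A | language_stable R X],
      Gdelta [set X : set_type (@positive_entropy R A)
             | language_stable R (\val X)] /\
      dense [set X : set_type (@positive_entropy R A)
            | language_stable R (\val X)] &
      forall c : R, 0 <= c ->
        Gdelta [set X : set_type (@entropy_ge R A c)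
               | language_stable R (\val X)] /\
        dense [set X : set_type (@entropy_ge R A c)
              | language_stable R (\val X)]].
Proof.
split=> [||c _].
- split; first exact: Gdelta_language_stable.
  move=> U [X UX] oU.
  have [Y [UY sY _]] := near_language_stable (open_nbhs_nbhs (conj oU UX)).
  by exists Y.
- by apply: Gdelta_dense_language_stable => X Y XY /lt_le_trans; apply; exact: le_entropy.
- by apply: Gdelta_dense_language_stable => X Y XY /le_trans; apply; exact: le_entropy.
Qed.
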